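(* Let $a,b$ be relatively prime positive integers and let $l$ be an integer with $a\equiv l\pmod b$ and $1<l<b$. Then $$ M_2(a;b) \ge \frac{(b^2+1)(a-1)(2a-1)}{6a^2} - \frac{(a-1)b}{2a} - \frac{2b}{a}\bigl( R(a,b) - R(b,l) + s(1,l)\bigr) $$ and $$ M_2(a;b) \le \frac{(b^2+1)(a-1)(2a-1)}{6a^2} - \frac{(a-1)b}{2a} - \frac{2b}{a}\bigl( R(a,b) - R(b,l) - s(1,l)\bigr). $$
   Context: For positive integers $a,b$: $M_2(a;b) = \frac1a\sum_{m=0}^{a-1}\left\lfloor\frac{mb}{a}\right\rfloor^2$, and $$R(a,b) = -\frac14 + \frac1{12}\left(\frac ab + \frac1{ab} + \frac ba\right).$$ The sawtooth function is $((x)) = x-\lfloor x\rfloor - \frac12$ if $x\notin\mathbb{Z}$ and $((x))=0$ if $x\in\mathbb{Z}$. The classical Dedekind sum is $s(a,b) = \sum_{k \bmod b} \left(\left(\frac{ka}{b}\right)\right)\left(\left(\frac kb\right)\right)$, the sum running over a complete residue system modulo $b$. *)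

(* Defs.v *)
From mathcomp Require Import all_boot all_order all_algebra.

Set Implicit Arguments.
Unset Strict Implicit.
Unset Printing Implicit Defensive.

Import Order.TTheory GRing.Theory Num.Theory.
Local Open Scope ring_scope.

(* Every quantity involved is rational, so the base field is [rat]. *)

Definition M2 (a b : nat) : rat :=
  a%:R^-1 * \sum_(0 <= m < a) ((Num.floor ((m * b)%:R / a%:R : rat))%:~R) ^+ 2.

Definition Rfun (a b : nat) : rat :=
  - (1 / 4) + (1 / 12) * (a%:R / b%:R + 1 / (a%:R * b%:R) + b%:R / a%:R).

Definition sawtooth (x : rat) : rat :=
  if x \is a Num.int then 0 else x - (Num.floor x)%:~R - 1 / 2.

(* The summand is [b]-periodic in [k]; the residue system used is 0, ..., b-1. *)
Definition dedekind_sum (a : int) (b : nat) : rat :=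
  \sum_(0 <= k < b) sawtooth (k%:R * a%:~R / b%:R) * sawtooth (k%:R / b%:R).

(* Main.v *)
Require Import Defs.
From mathcomp Require Import all_boot all_order all_algebra.
From mathcomp Require Import zify ring lra.

Import Order.TTheory GRing.Theory Num.Theory.
Local Open Scope ring_scope.

(** Write [k * b = a * f k + r k] for the Euclidean division of [k * b] by [a],
    so that [a * M2 a b] is the sum of the [f k ^ 2] over [k < a].

    Expanding [(k * b - r k) ^ 2] expresses this sum through the power sums of
    [k], those of [r k] (the same ones, as [r] permutes the residues modulo
    [a]) and the sum of the [k * r k], which is a Dedekind sum up to an
    elementary term: this is [M2_dedekind], and it turns the theorem into
    [|s(b, a) - R(a, b) + R(b, l)| <= s(1, l)].

    Counting with weight [j] the lattice points [(k, j)] with [j <= f k],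
    first along [k] and then along [j], yields a second expression, in which
    the Dedekind sum is [s(a, b)] instead of [s(b, a)]
    ([sum_floor_sqr_recip]).  Comparing the two gives the reciprocity law
    [s(a, b) + s(b, a) = R(a, b)].

    As [s(a, b)] depends only on [a] modulo [b], two uses of reciprocity give
    [s(b, a) = R(a, b) - s(l, b) = R(a, b) - R(b, l) + s(b, l)].  Finally
    [|s(b, l)| <= s(1, l)], because the two families multiplied in [s(b, l)]
    are rearrangements of each other, while [s(1, l)] is the sum of the
    squares of either of them. *)

(** * Power sums and residues *)

Lemma sum_nat_rat (n : nat) :
  \sum_(0 <= k < n) k%:R = n%:R * (n%:R - 1) / 2 :> rat.
Proof.
elim: n => [|n IHn]; first by rewrite big_geq // mul0r mul0r.
by rewrite big_nat_recr //= IHn -(natr1 n); field.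
Qed.

Lemma sum_sqr_nat_rat (n : nat) :
  \sum_(0 <= k < n) k%:R ^+ 2 = n%:R * (n%:R - 1) * (2 * n%:R - 1) / 6 :> rat.
Proof.
elim: n => [|n IHn]; first by rewrite big_geq // !mul0r.
by rewrite big_nat_recr //= IHn -(natr1 n); field.
Qed.

Lemma sum_modn_mul (V : nmodType) (a b : nat) (F : nat -> V) :
  (0 < b)%N -> coprime a b ->
  \sum_(0 <= k < b) F (k * a %% b)%N = \sum_(0 <= k < b) F k.
Proof.
move=> b_gt0 co_ab; rewrite !big_mkord.
pose h (i : 'I_b) := Ordinal (ltn_pmod (i * a) b_gt0).
have h_inj : injective h.
  move=> i j /(congr1 val) /= /eqP eq_ij; apply/val_inj => /=.
  wlog le_ij : i j eq_ij / (i <= j)%N.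
    by move=> IH; case/orP: (leq_total i j) => le_ij;
      [|apply/esym]; apply: IH; rewrite // eq_sym.
  move: eq_ij; rewrite eq_sym eqn_mod_dvd ?leq_mul2r ?le_ij ?orbT //.
  rewrite -mulnBl Gauss_dvdl 1?coprime_sym // => /dvdn_leq.
  by case: j le_ij => j /= j_lt; lia.
by rewrite [RHS](reindex_inj h_inj).
Qed.

Lemma modn_rat (n b : nat) :
  (n %% b)%:R = n%:R - b%:R * (n %/ b)%:R :> rat.
Proof. by rewrite {2}(divn_eq n b) natrD natrM; ring. Qed.

Lemma floor_ratio (n b : nat) :
  (0 < b)%N -> Num.floor (n%:R / b%:R : rat) = (n %/ b)%N.
Proof.
move=> b_gt0; have b_pos : 0 < b%:R :> rat by rewrite ltr0n.
apply: floor_def; rewrite ler_pdivlMr // ltr_pdivrMr //.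
rewrite -[(n %/ b)%N%:Z + 1]/((n %/ b + 1)%N%:Z) -!pmulrn.
by rewrite -!natrM ler_nat ltr_nat leq_divM addn1 ltn_ceil.
Qed.

Lemma int_ratio (n b : nat) :
  (0 < b)%N -> ((n%:R / b%:R : rat) \is a Num.int) = (b %| n)%N.
Proof.
move=> b_gt0; have b_neq0 : b%:R != 0 :> rat by rewrite pnatr_eq0 -lt0n.
rewrite intrEfloor floor_ratio // -pmulrn -(inj_eq (mulIf b_neq0)) divfK //.
by rewrite -natrM eqr_nat dvdn_eq.
Qed.

Lemma sawtooth_ratio (n b : nat) : (0 < b)%N ->
  sawtooth (n%:R / b%:R) =
  if (b %| n)%N then 0 else (n %% b)%:R / b%:R - 1 / 2.
Proof.
move=> b_gt0; have b_neq0 : b%:R != 0 :> rat by rewrite pnatr_eq0 -lt0n.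
rewrite /sawtooth int_ratio //; case: ifP => // _.
by rewrite floor_ratio // -pmulrn modn_rat; field.
Qed.

Lemma sawtooth_modn (n b : nat) : (0 < b)%N ->
  sawtooth ((n %% b)%:R / b%:R) = sawtooth (n%:R / b%:R).
Proof.
by move=> b_gt0; rewrite !sawtooth_ratio // modn_mod {1}/dvdn modn_mod.
Qed.

(** * Dedekind sums *)

Lemma dedekind_sumE (a b : nat) :
  dedekind_sum a b =
  \sum_(0 <= k < b) sawtooth ((k * a)%:R / b%:R) * sawtooth (k%:R / b%:R).
Proof. by apply: eq_bigr => k _; rewrite natrM -pmulrn. Qed.

Lemma dedekind_sum_mod (a l b : nat) : (0 < b)%N -> a = l %[mod b] ->
  dedekind_sum a b = dedekind_sum l b.
Proof.
move=> b_gt0 eq_al; rewrite !dedekind_sumE; apply: eq_bigr => k _.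
by rewrite -(sawtooth_modn (k * a)) // -modnMmr eq_al modnMmr sawtooth_modn.
Qed.

(** The inequality [2 * |x * y| <= x ^ 2 + y ^ 2] is applied termwise; since
    multiplication by [b] permutes the residues modulo [l], the squares [x ^ 2]
    and the squares [y ^ 2] both sum to [s(1, l)]. *)
Lemma dedekind_sum_bound (b l : nat) : (0 < l)%N -> coprime b l ->
  - dedekind_sum 1 l <= dedekind_sum b l <= dedekind_sum 1 l.
Proof.
move=> l_gt0 co_bl; rewrite -[1 : int]/(1%N : int) !dedekind_sumE.
set S := (X in - X <= _).
have SE : S = \sum_(0 <= k < l) sawtooth (k%:R / l%:R) ^+ 2.
  by apply: eq_bigr => k _; rewrite muln1 expr2.
have sum_perm : \sum_(0 <= k < l) sawtooth ((k * b)%:R / l%:R) ^+ 2 = S.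
  rewrite SE -(@sum_modn_mul _ b l (fun k => sawtooth (k%:R / l%:R) ^+ 2)) //.
  by apply: eq_bigr => k _; rewrite sawtooth_modn.
set T := (X in _ <= X <= _).
have S2E : S + S = \sum_(0 <= k < l)
    (sawtooth ((k * b)%:R / l%:R) ^+ 2 + sawtooth (k%:R / l%:R) ^+ 2).
  by rewrite big_split /= sum_perm -SE.
have upper : 0 <= (S + S) - 2 * T.
  rewrite S2E /T mulr_sumr -sumrB sumr_ge0 // => k _.
  set x := sawtooth _; set y := sawtooth _.
  suff -> : x ^+ 2 + y ^+ 2 - 2 * (x * y) = (x - y) ^+ 2 by exact: sqr_ge0.
  by ring.
have lower : 0 <= (S + S) + 2 * T.
  rewrite S2E /T mulr_sumr -big_split sumr_ge0 //= => k _.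
  set x := sawtooth _; set y := sawtooth _.
  suff -> : x ^+ 2 + y ^+ 2 + 2 * (x * y) = (x + y) ^+ 2 by exact: sqr_ge0.
  by ring.
by rewrite -/S; apply/andP; split; lra.
Qed.

(** Away from [k = 0] both sawtooth arguments are non-integral, so the two
    factors expand; the term [k = 0] would contribute [1 / 4] instead of [0]. *)
Lemma sum_mul_modn (a b : nat) : (0 < b)%N -> coprime a b ->
  \sum_(0 <= k < b) k%:R * (k * a %% b)%:R =
  b%:R ^+ 2 * (dedekind_sum a b + (b%:R - 1) / 4) :> rat.
Proof.
move=> b_gt0 co_ab; have b_neq0 : b%:R != 0 :> rat by rewrite pnatr_eq0 -lt0n.
set S := LHS.
have sE : dedekind_sum a b = \sum_(0 <= k < b)
   (k%:R * (k * a %% b)%:R * (b%:R ^- 2)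
    - (k * a %% b)%:R / (2 * b%:R) - k%:R / (2 * b%:R) + 4^-1
    - (k == 0)%N%:R / 4).
  rewrite dedekind_sumE; apply: eq_big_nat => k /andP[_ lt_kb].
  rewrite !sawtooth_ratio // Gauss_dvdl 1?coprime_sym //.
  case: (posnP k) => [->|k_gt0].
    by rewrite dvdn0 mul0n mod0n /= !mul0r; field.
  by rewrite gtnNdvd // (modn_small lt_kb) /=; field.
rewrite sE !(sumrB, big_split) /= -!mulr_suml -/S.
rewrite (@sum_modn_mul _ a b (fun k => k%:R)) // sum_nat_rat.
rewrite sumr_const_nat subn0.
rewrite (big_ltn b_gt0) /= big_nat big1 ?addr0; last by case.
by rewrite -mulr_natr; field.
Qed.

(** * Sums of floors *)

Lemma sum_divn (a b : nat) : (0 < a)%N -> coprime b a ->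
  \sum_(0 <= k < a) (k * b %/ a)%:R = (a%:R - 1) * (b%:R - 1) / 2 :> rat.
Proof.
move=> a_gt0 co_ba; have a_neq0 : a%:R != 0 :> rat by rewrite pnatr_eq0 -lt0n.
have := @sum_modn_mul rat b a (fun k => k%:R) a_gt0 co_ba.
under eq_bigr do rewrite modn_rat natrM.
rewrite sumrB -mulr_suml -mulr_sumr sum_nat_rat => sumE.
by apply: (mulfI a_neq0); lra.
Qed.

Lemma sum_floor_sqr (a b : nat) : (0 < a)%N -> coprime b a ->
  \sum_(0 <= k < a) (k * b %/ a)%:R ^+ 2 =
  (b%:R ^+ 2 + 1) * (a%:R - 1) * (2 * a%:R - 1) / (6 * a%:R)
  - 2 * b%:R * (dedekind_sum b a + (a%:R - 1) / 4) :> rat.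
Proof.
move=> a_gt0 co_ba; have a_neq0 : a%:R != 0 :> rat by rewrite pnatr_eq0 -lt0n.
have -> : \sum_(0 <= k < a) (k * b %/ a)%:R ^+ 2 = \sum_(0 <= k < a)
    (k%:R ^+ 2 * (b%:R / a%:R) ^+ 2
     - k%:R * (k * b %% a)%:R * (2 * b%:R / a%:R ^+ 2)
     + (k * b %% a)%:R ^+ 2 / a%:R ^+ 2) :> rat.
  by apply: eq_bigr => k _; rewrite modn_rat natrM; field.
rewrite big_split sumrB /= -!mulr_suml sum_mul_modn //.
rewrite (@sum_modn_mul _ b a (fun k => k%:R ^+ 2)) // sum_sqr_nat_rat.
by field.
Qed.

Lemma M2_dedekind (a b : nat) : (0 < a)%N -> coprime b a ->
  M2 a b = (b%:R ^+ 2 + 1) * (a%:R - 1) * (2 * a%:R - 1) / (6 * a%:R ^+ 2)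
           - (a%:R - 1) * b%:R / (2 * a%:R)
           - 2 * b%:R / a%:R * dedekind_sum b a.
Proof.
move=> a_gt0 co_ba; have a_neq0 : a%:R != 0 :> rat by rewrite pnatr_eq0 -lt0n.
rewrite /M2; under eq_bigr do rewrite floor_ratio // -pmulrn.
by rewrite sum_floor_sqr //; field.
Qed.

Lemma sum_below (f n : nat) : (f < n)%N ->
  \sum_(0 <= j < n) j%:R * (j <= f)%N%:R = f%:R * (f%:R + 1) / 2 :> rat.
Proof.
move=> lt_fn; rewrite (big_cat_nat (n := f.+1)) //= addrC.
rewrite big_nat big1 ?add0r => [|j /andP[lt_fj _]]; last first.
  by rewrite leqNgt lt_fj mulr0.
transitivity (\sum_(0 <= j < f.+1) j%:R : rat).
  by apply: eq_big_nat => j /andP[_]; rewrite ltnS => ->; rewrite mulr1.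
by rewrite sum_nat_rat -(natr1 f); field.
Qed.

Lemma sum_above (q n : nat) : (q < n)%N ->
  \sum_(0 <= k < n) (q < k)%N%:R = n%:R - 1 - q%:R :> rat.
Proof.
move=> lt_qn; rewrite (big_cat_nat (n := q.+1)) //=.
rewrite big_nat big1 ?add0r => [|k /andP[_ lt_kq]]; last first.
  by rewrite ltnNge -ltnS lt_kq.
transitivity (\sum_(q.+1 <= k < n) 1 : rat).
  by apply: eq_big_nat => k /andP[-> _].
by rewrite sumr_const_nat natrB // -(natr1 q); ring.
Qed.

(** No lattice point with [0 < j < b] lies on the line [j * a = k * b]. *)
Lemma leq_divn_coprime (a b j k : nat) : (0 < a)%N -> coprime a b ->
  (0 < j < b)%N -> (j <= k * b %/ a)%N = (j * a %/ b < k)%N.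
Proof.
move=> a_gt0 co_ab /andP[j_gt0 lt_jb].
have b_gt0 : (0 < b)%N by apply: leq_ltn_trans lt_jb.
rewrite leq_divRL // ltn_divLR // leq_eqVlt; case: eqP => //= eq_jk.
have : (b %| j * a)%N by rewrite eq_jk dvdn_mull.
by rewrite Gauss_dvdl 1?coprime_sym // gtnNdvd.
Qed.

(** Both sides count the points [(k, j)] below the diagonal of the [a] by [b]
    rectangle, each with weight [j]. *)
Lemma sum_floor_exchange (a b : nat) : (0 < a)%N -> (0 < b)%N -> coprime a b ->
  \sum_(0 <= k < a) (k * b %/ a)%:R * ((k * b %/ a)%:R + 1) / 2 =
  \sum_(0 <= j < b) j%:R * (a%:R - 1 - (j * a %/ b)%:R) :> rat.
Proof.
move=> a_gt0 b_gt0 co_ab.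
transitivity (\sum_(0 <= k < a) \sum_(0 <= j < b)
    j%:R * (j <= k * b %/ a)%N%:R : rat).
  apply: eq_big_nat => k /andP[_ lt_ka]; rewrite sum_below //.
  by rewrite ltn_divLR // mulnC ltn_pmul2l.
rewrite exchange_big_nat /=; apply: eq_big_nat => j /andP[_ lt_jb].
case: (posnP j) => [->|j_gt0]; first by rewrite mul0r big1 // => k; rewrite mul0r.
rewrite -mulr_sumr -sum_above; last by rewrite ltn_divLR // mulnC ltn_pmul2l.
by congr (_ * _); apply: eq_bigr => k _; rewrite leq_divn_coprime // j_gt0.
Qed.

Lemma sum_floor_sqr_recip (a b : nat) :
  (0 < a)%N -> (0 < b)%N -> coprime a b ->
  \sum_(0 <= k < a) (k * b %/ a)%:R ^+ 2 =
  (a%:R - 1) * (b%:R - 1) * (b%:R - 1 / 2)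
  - a%:R * (b%:R - 1) * (2 * b%:R - 1) / 3
  + 2 * b%:R * (dedekind_sum a b + (b%:R - 1) / 4) :> rat.
Proof.
move=> a_gt0 b_gt0 co_ab.
have b_neq0 : b%:R != 0 :> rat by rewrite pnatr_eq0 -lt0n.
have := sum_floor_exchange _ _ a_gt0 b_gt0 co_ab.
under eq_bigr do rewrite mulrDr mulr1 -expr2.
rewrite -mulr_suml big_split /= sum_divn 1?coprime_sym //.
have -> : \sum_(0 <= j < b) j%:R * (a%:R - 1 - (j * a %/ b)%:R) =
    \sum_(0 <= j < b) (j%:R * (a%:R - 1) - j%:R ^+ 2 * (a%:R / b%:R)
                       + j%:R * (j * a %% b)%:R / b%:R) :> rat.
  by apply: eq_bigr => j _; rewrite modn_rat natrM; field.
rewrite big_split sumrB /= -!mulr_suml sum_mul_modn // sum_nat_rat.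
rewrite sum_sqr_nat_rat; set S := (\sum_(_ <= _ < _) _) => S_eq.
(* Bring out the left-hand side of [S_eq]. *)
have -> : S = 2 * ((S + (a%:R - 1) * (b%:R - 1) / 2) / 2)
              - (a%:R - 1) * (b%:R - 1) / 2 by field.
by rewrite S_eq; field.
Qed.

Lemma dedekind_reciprocity (a b : nat) :
  (0 < a)%N -> (0 < b)%N -> coprime a b ->
  dedekind_sum a b + dedekind_sum b a = Rfun a b.
Proof.
move=> a_gt0 b_gt0 co_ab.
have a_neq0 : a%:R != 0 :> rat by rewrite pnatr_eq0 -lt0n.
have b_neq0 : b%:R != 0 :> rat by rewrite pnatr_eq0 -lt0n.
have := sum_floor_sqr_recip _ _ a_gt0 b_gt0 co_ab.
rewrite sum_floor_sqr 1?coprime_sym // => eq_sums.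
have two_b_neq0 : 2 * b%:R != 0 :> rat by rewrite mulf_neq0.
apply: (mulfI two_b_neq0); rewrite mulrDr.
set x := dedekind_sum a b in eq_sums *; set y := dedekind_sum b a in eq_sums *.
(* Bring out the first expression of the sum of squares, to trade it for the
   second one, in which [s(a, b)] occurs. *)
have -> : 2 * b%:R * y =
  (b%:R ^+ 2 + 1) * (a%:R - 1) * (2 * a%:R - 1) / (6 * a%:R)
  - 2 * b%:R * ((a%:R - 1) / 4)
  - ((b%:R ^+ 2 + 1) * (a%:R - 1) * (2 * a%:R - 1) / (6 * a%:R)
     - 2 * b%:R * (y + (a%:R - 1) / 4)) by field.
by rewrite eq_sums /Rfun; field; rewrite a_neq0.
Qed.

(** * The bounds *)

Theorem theorem5 (a b l : nat) (ha : (0 < a)%N) (hb : (0 < b)%N)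
    (hab : coprime a b) (hal : a = l %[mod b]) (hl1 : (1 < l)%N)
    (hlb : (l < b)%N) :
  (M2 a b >=
     (b%:R ^+ 2 + 1) * (a%:R - 1) * (2 * a%:R - 1) / (6 * a%:R ^+ 2)
     - (a%:R - 1) * b%:R / (2 * a%:R)
     - 2 * b%:R / a%:R * (Rfun a b - Rfun b l + dedekind_sum 1 l))
  /\
  (M2 a b <=
     (b%:R ^+ 2 + 1) * (a%:R - 1) * (2 * a%:R - 1) / (6 * a%:R ^+ 2)
     - (a%:R - 1) * b%:R / (2 * a%:R)
     - 2 * b%:R / a%:R * (Rfun a b - Rfun b l - dedekind_sum 1 l)).
Proof.
have l_gt0 : (0 < l)%N by apply: ltnW.
have co_bl : coprime b l by rewrite -coprime_modr -hal coprime_modr coprime_sym.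
have recip_ab := dedekind_reciprocity _ _ ha hb hab.
have recip_bl := dedekind_reciprocity _ _ hb l_gt0 co_bl.
have mod_al := dedekind_sum_mod _ _ _ hb hal.
have /andP[lower upper] := dedekind_sum_bound _ _ l_gt0 co_bl.
have coef_ge0 : 0 <= 2 * b%:R / a%:R :> rat.
  by rewrite divr_ge0 ?mulr_ge0 ?ler0n.
rewrite M2_dedekind 1?coprime_sym //.
by split; rewrite lerD2l lerN2; apply: ler_wpM2l => //; lra.
Qed.
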